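(* (Classical mathematics.) Let $X$ be a spectral space and $\ell\in\mathbb{N}$. Then $X$ is of dimension $\le\ell-1$ if and only if for any compact open subsets $x_1,\ldots,x_\ell$ of $X$ $$X=x_\ell\vee(x_\ell\rightarrow\cdots(x_2\vee(x_2\rightarrow(x_1\vee\neg x_1)))\cdots).$$ Precisely, the right-hand side is $e_\ell$, where $e_0=\emptyset$ and $e_k=x_k\vee(x_k\rightarrow e_{k-1})$ for $1\le k\le\ell$.
   Context: A topological space $X$ is spectral if (a) $X$ is a compact $T_0$-space (compact does not include Hausdorff); (b) $X$ has a basis of compact open sets which is closed under finite intersections; (c) each irreducible closed subspace of $X$ has a generic point. For open subsets $U,V$ of $X$, $U\vee V$ is the union, $U\rightarrow V$ is the largest open $W$ such that $W\cap U\subseteq V$, and $\neg U=U\rightarrow\emptyset$. A spectral space is of dimension $\le\ell-1$ if there is no strictly increasing chain of length $\ell$ of irreducible closed subsets of $X$, i.e. no chain $Z_0\subsetneq Z_1\subsetneq\cdots\subsetneq Z_\ell$ of irreducible closed subsets. *)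

(* Defs.v *)
From HB Require Import structures.
From mathcomp Require Import all_boot all_classical all_analysis.

Set Implicit Arguments.
Unset Strict Implicit.
Unset Printing Implicit Defensive.

Local Open Scope classical_set_scope.

Section spectral.
Variable X : topologicalType.
Implicit Types (U V W Z : set X).

(* Irreducibility of the subspace [Z]: the closed sets of the subspace are the
   traces on [Z] of closed sets of [X].  The empty set is not irreducible. *)
Definition irreducible Z : Prop :=
  Z !=set0 /\
  forall F G, closed F -> closed G -> Z `<=` F `|` G -> Z `<=` F \/ Z `<=` G.

(* [X] need be neither Hausdorff nor inhabited; [topologicalType] and [compact]
   require neither. *)
Definition spectral_space : Prop :=
  [/\ compact [set: X] /\ kolmogorov_space X,
      exists B : set (set X), [/\ basis B, B `<=` compact & setI_closed B]
    & forall Z, closed Z -> irreducible Z -> exists x, closure [set x] = Z].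

(* "dimension <= l - 1"; for l = 0 this says that [X] has no irreducible closed
   subset at all. *)
Definition dim_le_pred (l : nat) : Prop :=
  ~ exists Z : nat -> set X,
      (forall k, (k <= l)%N -> closed (Z k) /\ irreducible (Z k)) /\
      (forall k, (k < l)%N -> Z k `<` Z k.+1).

Definition heyting_imp U V : set X :=
  \bigcup_(W in [set W | open W /\ W `&` U `<=` V]) W.

Lemma open_heyting_imp U V : open (heyting_imp U V).
Proof. by apply: bigcup_open => W []. Qed.

(* Taking [W := heyting_imp U V], this shows that the union defining
   [heyting_imp U V] is the largest open [W] with [W `&` U `<=` V]. *)
Lemma sub_heyting_imp U V W :
  open W -> (W `<=` heyting_imp U V <-> W `&` U `<=` V).
Proof.
move=> oW; split=> [WUV x [/WUV[W' [_ W'UV] W'x] Ux]|WUV x Wx].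
  exact: W'UV.
by exists W.
Qed.

(* [heyting_e x k] is e_k, with [x 1], [x 2], ... standing for x_1, x_2, ...
   ([x 0] is never used).  As [heyting_imp U set0] is the negation of [U],
   e_1 is the innermost term [x_1 \/ ~ x_1]. *)
Fixpoint heyting_e (x : nat -> set X) (k : nat) : set X :=
  if k is k'.+1 then x k `|` heyting_imp (x k) (heyting_e x k') else set0.

End spectral.

Arguments spectral_space : clear implicits.
Arguments dim_le_pred : clear implicits.

(* Main.v *)
Require Import Defs.
From mathcomp Require Import all_boot all_classical all_analysis.

(** A point [p] lies outside [heyting_e x k.+1] exactly when [p] is not in
    [x k.+1] but every neighbourhood of [p] meets [x k.+1] outside
    [heyting_e x k].  So avoiding [heyting_e x l] should amount to climbing [l]
    times from a closed irreducible set to a strictly larger one, step [k] being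
    witnessed by a compact open set that meets the larger set and misses the
    smaller one.

    From a chain to a point: choose for each step of the chain a compact open
    set separating its two members.  Two open sets that meet an irreducible set
    meet each other inside it, and this makes [heyting_e x k] disjoint from the
    [k]-th member of the chain counted from the top
    ([heyting_step_disjoint]).  The bottom member is not empty, so
    [heyting_e x l] is not the whole space.

    From a point to a chain: given [p] outside [heyting_e x k.+1], one looks for
    a single point [q] of [x k.+1], outside [heyting_e x k], whose closure
    contains [p]; that closure is then strictly larger than the closure of [p],
    and one recurses from [q].  That the same [q] can serve all
    neighbourhoods of [p] is the main use of spectrality
    ([spectral_generization]): the limits of an ultrafilter form a closed irreducible set
    ([ultra_limits_irreducible]), and its generic point is the required [q]. *)

Local Open Scope classical_set_scope.

(** * Irreducible sets *)

Lemma irreducibleP (X : topologicalType) (Z : set X) :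
  irreducible Z <->
  Z !=set0 /\
  forall U V, open U -> open V -> Z `&` U !=set0 -> Z `&` V !=set0 ->
    Z `&` (U `&` V) !=set0.
Proof.
split=> [[Z0 irrZ]|[Z0 meetZ]]; split=> //.
  move=> U V oU oV [u [Zu Uu]] [v [Zv Vv]].
  apply: contrapT => nUV.
  have cover : Z `<=` ~` U `|` ~` V.
    by move=> z Zz; rewrite -setCI => UVz; apply: nUV; exists z.
  case: (irrZ _ _ (open_closedC oU) (open_closedC oV) cover) => sub.
    exact: (sub u Zu Uu).
  exact: (sub v Zv Vv).
move=> F G cF cG ZFG.
apply: contrapT => /not_orP[/existsNP[a /not_implyP[Za nFa]]].
move=> /existsNP[b /not_implyP[Zb nGb]].
have aF : Z `&` ~` F !=set0 by exists a.
have bG : Z `&` ~` G !=set0 by exists b.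
have [z [/ZFG FGz [nFz nGz]]] :=
  meetZ _ _ (closed_openC cF) (closed_openC cG) aF bG.
by case: FGz.
Qed.

Lemma irreducible_closure1 (X : topologicalType) (p : X) :
  irreducible (closure [set p]).
Proof.
split=> [|F G cF cG sub].
  by exists p; apply: subset_closure.
have hull H : closed H -> H p -> closure [set p] `<=` H.
  by move=> cH Hp; rewrite (closure_id H).1//; apply: closureS => _ ->.
by case: (sub p (subset_closure (erefl p))) => ?; [left|right]; apply: hull.
Qed.

Lemma closure1_sub (X : topologicalType) (p q : X) :
  closure [set q] p -> closure [set p] `<=` closure [set q].
Proof.
move=> qp; rewrite [X in _ `<=` X](closure_id _).1; last exact: closed_closure.
by apply: closureS => _ ->.
Qed.

(** * Compact open sets of a spectral space *)

Lemma basis_nbhs (X : topologicalType) (B : set (set X)) (U : set X) (x : X) :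
  basis B -> nbhs x U -> exists b, [/\ B b, b x & b `<=` U].
Proof. by move=> [_ nB] /nB[b [Bb bx] bU]; exists b. Qed.

Lemma spectral_compact_open_separation (X : topologicalType) (Z F : set X) :
  spectral_space X -> closed F -> ~ Z `<=` F ->
  exists b, [/\ open b, compact b, Z `&` b !=set0 & F `&` b = set0].
Proof.
move=> [_ [B [basB Bc _]] _] cF /existsNP[z /not_implyP[Zz nFz]].
have /(basis_nbhs _ _ _ _ basB)[b [Bb bz bF]] : nbhs z (~` F).
  by apply: open_nbhs_nbhs; split=> //; apply: closed_openC.
exists b; split; [exact: basB.1|exact: Bc|by exists z|].
by apply/disjoints_subset => y Fy /bF.
Qed.

(** Open sets containing a limit of [G] belong to [G], and they can be shrunk to
    basic ones.  The intersection of two such basic sets is again in [G] and is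
    again compact, so it contains a limit of [G]. *)
Lemma ultra_limits_irreducible (X : topologicalType) (G : set_system X) :
  spectral_space X -> UltraFilter G -> irreducible [set y : X | nbhs y `<=` G].
Proof.
move=> [[cX _] [B [basB Bc BI]] _] GU.
have lim A : compact A -> G A -> exists y, A y /\ nbhs y `<=` G.
  by rewrite compact_ultra => /(_ G GU) h /h [y [Ay Gy]]; exists y.
apply/irreducibleP; split=> [|U V oU oV [u [Gu Uu]] [v [Gv Vv]]].
  by have [|y [_ Gy]] := lim _ cX; [exact: filterT|exists y].
have [b [Bb bu bU]] := basis_nbhs _ _ _ _ basB (open_nbhs_nbhs (conj oU Uu)).
have [c [Bc' cv cV]] := basis_nbhs _ _ _ _ basB (open_nbhs_nbhs (conj oV Vv)).
have Gb : G b by apply/Gu/open_nbhs_nbhs; split=> //; apply: basB.1.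
have Gc : G c by apply/Gv/open_nbhs_nbhs; split=> //; apply: basB.1.
have [y [[yb yc] Gy]] := lim _ (Bc _ (BI _ _ Bb Bc')) (filterI Gb Gc).
by exists y; split=> //; split; [exact: bU|exact: cV].
Qed.

(** * Generizations *)

(** The ultrafilter refines the trace on [A `&` K] of the neighbourhoods of [p],
    so that [p] is one of its limits, all its limits are in the closed set [A],
    and one of them is in the compact set [K].  Openness of [K] passes this last
    property on to the generic point of the limit set. *)
Lemma spectral_generization (X : topologicalType) (A K : set X) (p : X) :
  spectral_space X -> closed A -> open K -> compact K ->
  closure (A `&` K) p -> exists q, [/\ A q, K q & closure [set q] p].
Proof.
move=> hX cA oK cK clp.
have /ultraFilterLemma[G [GU subG]] := within_nbhs_proper clp.
have GAK : G (A `&` K) by apply: subG; apply: withinT.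
have GA : G A by apply: filterS GAK => x [].
have GK : G K by apply: filterS GAK => x [].
pose L := [set y : X | nbhs y `<=` G].
have cL : closed L.
  move=> y clLy B /nbhs_interior By.
  by have [z [Lz Bz]] := clLy _ By; apply: Lz.
have [_ _ generic] := hX.
have [q qL] := generic L cL (ultra_limits_irreducible _ _ hX GU).
have Lp : L p.
  by move=> B pB; apply: subG; rewrite /within /=; near=> x => _; near: x.
exists q; split.
- have : L q by rewrite -qL; apply: subset_closure.
  move=> Lq; apply: cA => B /Lq GB; exact: filter_ex (filterI GA GB).
- have [y [Ky Ly]] : K `&` L !=set0.
    by move: cK; rewrite compact_ultra => /(_ G GU GK).
  have [q' [-> //]] : [set q] `&` K !=set0.
  by have : closure [set q] y; [rewrite qL|apply; apply: open_nbhs_nbhs].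
- by rewrite qL.
Unshelve. all: by end_near. Qed.

(** * Chains and iterated Heyting implications *)

(** An open set [W] that meets [Y] also meets [Z], hence meets [U] inside the
    irreducible set [Z], at a point outside [V]; so [W] is none of the sets
    whose union is [heyting_imp U V]. *)
Lemma heyting_step_disjoint (X : topologicalType) (Y Z U V : set X) :
  irreducible Z -> open U -> Y `<=` Z -> Z `&` U !=set0 ->
  Y `&` U = set0 -> Z `&` V = set0 -> Y `&` (U `|` heyting_imp U V) = set0.
Proof.
move=> /irreducibleP[_ meetZ] oU YZ ZU YU ZV.
rewrite -subset0 => y [Yy [Uy|[W [oW WUV] Wy]]].
  have : (Y `&` U) y by [].
  by rewrite YU.
have ZW : Z `&` W !=set0 by exists y; split=> //; apply: YZ.
have [z [Zz [Wz Uz]]] := meetZ _ _ oW oU ZW ZU.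
have : (Z `&` V) z by split=> //; apply: WUV.
by rewrite ZV.
Qed.

Lemma closure_of_notin_heyting_imp (X : topologicalType) (U V : set X) (p : X) :
  ~ heyting_imp U V p -> closure (~` V `&` U) p.
Proof.
move=> nimp B pB; apply: contrapT => empty; apply: nimp.
exists (B^°); last exact: pB.
split; first exact: open_interior.
move=> x [/interior_subset Bx Ux]; apply: contrapT => nVx.
by apply: empty; exists x.
Qed.

Lemma open_heyting_e (X : topologicalType) (x : nat -> set X) (k : nat) :
  (forall i, (1 <= i <= k)%N -> open (x i)) -> open (heyting_e x k).
Proof.
case: k => [_|k ox] /=; first exact: open0.
by apply: openU; [apply: ox; rewrite leqnn|apply: open_heyting_imp].
Qed.

(** Fixing the bottom of the chain to be the closure of [p] is what lets the
    induction put one more member below it. *)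
Lemma spectral_notin_heyting_e_chain
    (X : topologicalType) (x : nat -> set X) (k : nat) (p : X) :
  spectral_space X ->
  (forall i, (1 <= i <= k)%N -> open (x i) /\ compact (x i)) ->
  ~ heyting_e x k p ->
  exists Z : nat -> set X,
    [/\ Z 0%N = closure [set p],
        forall i, (i <= k)%N -> closed (Z i) /\ irreducible (Z i)
      & forall i, (i < k)%N -> Z i `<` Z i.+1].
Proof.
move=> hX; elim: k p => [|k IHk] p xP.
  move=> _; exists (fun=> closure [set p]); split=> // i _.
  by split; [apply: closed_closure|apply: irreducible_closure1].
move=> /not_orP[nxp /closure_of_notin_heyting_imp clp].
have [ox cx] : open (x k.+1) /\ compact (x k.+1) by apply: xP; rewrite leqnn.
have xP' i : (1 <= i <= k)%N -> open (x i) /\ compact (x i).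
  by case/andP=> i1 ik; apply: xP; rewrite i1 leqW.
have ce : closed (~` heyting_e x k).
  by apply: open_closedC; apply: open_heyting_e => i /xP'[].
have [q [nq xq qp]] := spectral_generization _ _ _ _ hX ce ox cx clp.
have [Z [Z0 Zirr Zlt]] := IHk q xP' nq.
exists (fun i => if i is j.+1 then Z j else closure [set p]); split=> //.
  case=> [_|i]; last exact: Zirr.
  by split; [apply: closed_closure|apply: irreducible_closure1].
case=> [_|i]; last exact: Zlt.
rewrite Z0; split; first exact: closure1_sub.
(* [x k.+1] is a neighbourhood of [q] that misses [p] *)
move=> /(_ q (subset_closure (erefl q)) _ (open_nbhs_nbhs (conj ox xq))).
by move=> [_ [->]].
Qed.

Lemma chain_disjoint_heyting_e
    (X : topologicalType) (x Z : nat -> set X) (l : nat) :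
  (forall k, (k <= l)%N -> irreducible (Z k)) ->
  (forall k, (k < l)%N -> Z k `<=` Z k.+1) ->
  (forall k, (k < l)%N -> [/\ open (x (l - k)%N),
    Z k.+1 `&` x (l - k)%N !=set0 & Z k `&` x (l - k)%N = set0]) ->
  Z 0%N `&` heyting_e x l = set0.
Proof.
move=> irrZ subZ sepx.
suff main k : (k <= l)%N -> Z (l - k)%N `&` heyting_e x k = set0.
  by have := main l (leqnn l); rewrite subnn.
elim: k => [_|k IHk kl]; first exact: setI0.
have lt : (l - k.+1 < l)%N by rewrite ltn_subrL (leq_trans _ kl).
have succ : (l - k.+1).+1 = (l - k)%N by rewrite -subSn.
have [] := sepx _ lt; rewrite subKn// succ => ox meet miss.
apply: (heyting_step_disjoint _ _ (Z (l - k)%N)) => //.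
- by apply: irrZ; apply: leq_subr.
- by rewrite -succ; apply: subZ.
- by apply: IHk; apply: ltnW.
Qed.

Theorem theorem2p14 (X : topologicalType) (l : nat) (hX : spectral_space X) :
  dim_le_pred X l <->
  (forall x : nat -> set X,
     (forall k : nat, (1 <= k <= l)%N -> open (x k) /\ compact (x k)) ->
     [set: X] = heyting_e x l).
Proof.
split=> [dimX x xP|allx [Z [Zirr Zlt]]].
  apply/esym; rewrite -subTset => p _; apply: contrapT => np.
  have [Z [_ Zirr Zlt]] := spectral_notin_heyting_e_chain _ _ _ _ hX xP np.
  by apply: dimX; exists Z.
have /choice[b bP] k : exists b : set X, (k < l)%N ->
    [/\ open b, compact b, Z k.+1 `&` b !=set0 & Z k `&` b = set0].
  have [kl|] := boolP (k < l)%N; last by exists set0.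
  have [_ nsub] := Zlt k kl.
  have [cZ _] := Zirr k (ltnW kl).
  by have [b ?] := spectral_compact_open_separation _ _ _ hX cZ nsub; exists b.
(* the innermost set [x 1] has to separate the two largest members of the
   chain, hence the reversal of the indices *)
pose x k := b (l - k)%N.
have disj : Z 0%N `&` heyting_e x l = set0.
  apply: chain_disjoint_heyting_e => k kl.
  - by have [] := Zirr k kl.
  - by have [] := Zlt k kl.
  - by rewrite /x subKn 1?ltnW//; have [] := bP k kl.
have [_ [[z Zz] _]] := Zirr 0%N (leq0n l).
suff eT : [set: X] = heyting_e x l.
  by rewrite -eT setIT in disj; rewrite disj in Zz.
apply: allx => k /andP[k1 kl].
have lt : (l - k < l)%N by rewrite ltn_subrL k1 (leq_trans k1 kl).
by have [] := bP _ lt.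
Qed.
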